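(* Let $\mathbf{X}=(X_1,\dots,X_n)\sim\mu$ be a random vector in $\mathbb{R}^n$ with finite second moment and with uncorrelated entries, and denote by $\Sigma$ the diagonal matrix describing the covariance of $\mathbf{X}$; assume that $\Sigma$ is invertible and that every entry $X_i$ has non-zero mean. Then $$G_2(\mathbf{X})=G\big(CV(X_1),\dots,CV(X_n)\big),\qquad\text{where}\qquad G(y_1,y_2,\dots,y_n)=\sqrt{\frac{n}{y_1^{-2}+\dots+y_n^{-2}}}.$$ In particular, $G_2(\mathbf{X})$ is the harmonic mean of the coefficients of variation $CV(X_1),\dots,CV(X_n)$ of the entries of $\mathbf{X}$.
   Context: For a real random variable $X$ with mean $m\neq 0$ and standard deviation $\sigma$, the coefficient of variation is $CV(X)=\sigma/|m|$. For a random vector $\mathbf{X}\sim\mu$ in $\mathbb{R}^n$ with finite second moment, mean $\mathbf{m}\neq 0$ and invertible covariance matrix $\Sigma$, $$G_2(\mathbf{X})=G_2(\mu):=\Bigg(\frac{1}{2\mathbf{m}^T\Sigma^{-1}\mathbf{m}}\int_{\mathbb{R}^n}\int_{\mathbb{R}^n}(\mathbf{x}-\mathbf{y})^T\Sigma^{-1}(\mathbf{x}-\mathbf{y})\,\mu(d\mathbf{x})\,\mu(d\mathbf{y})\Bigg)^{1/2}.$$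
   Formalization: The last sentence fails for the usual harmonic mean (CVs 1 and 2 give G_2 = sqrt(8/5), not 4/3); it is replaced by: the square of G_2(X) is the harmonic mean of the squared coefficients of variation. *)

(* Defs.v *)
From mathcomp Require Import all_boot all_order all_algebra.
From mathcomp Require Import all_classical all_reals all_analysis.

Set Implicit Arguments.
Unset Strict Implicit.
Unset Printing Implicit Defensive.

Import Order.TTheory GRing.Theory Num.Theory.
Import numFieldNormedType.Exports.

Local Open Scope classical_set_scope.
Local Open Scope ring_scope.

(* A vector of R^n is an [n.-tuple R]: this type carries the product
   sigma-algebra of the Borel sigma-algebra of R, i.e. the Borel sets of R^n.
   [tvec] turns it into a column vector for matrix algebra. *)
Definition tvec (R : realType) (n : nat) (x : n.-tuple R) : 'cV[R]_n :=
  \col_i tnth x i.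

Definition entry (R : realType) (n : nat) (T : Type) (X : T -> n.-tuple R)
    (i : 'I_n) : T -> R :=
  fun t => tnth (X t) i.

Definition finite_second_moment (R : realType) (n : nat) (d : measure_display)
    (T : measurableType d) (P : probability T R) (X : T -> n.-tuple R) : Prop :=
  (\int[P]_t (\sum_(i < n) entry X i t ^+ 2)%:E < +oo)%E.

Definition mean_vec (R : realType) (n : nat) (d : measure_display)
    (T : measurableType d) (P : probability T R) (X : T -> n.-tuple R) :
    'cV[R]_n :=
  \col_i fine ('E_P[entry X i])%E.

Definition cov_mx (R : realType) (n : nat) (d : measure_display)
    (T : measurableType d) (P : probability T R) (X : T -> n.-tuple R) :
    'M[R]_n :=
  \matrix_(i, j) fine (covariance P (entry X i) (entry X j)).

Definition uncorrelated_entries (R : realType) (n : nat) (d : measure_display)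
    (T : measurableType d) (P : probability T R) (X : T -> n.-tuple R) : Prop :=
  forall i j : 'I_n, i != j -> covariance P (entry X i) (entry X j) = 0%E.

Definition CV (R : realType) (d : measure_display) (T : measurableType d)
    (P : probability T R) (X : T -> R) : R :=
  Num.sqrt (fine ('V_P[X])%E) / `|fine ('E_P[X])%E|.

Definition qform (R : realType) (n : nat) (A : 'M[R]_n) (v : 'cV[R]_n) : R :=
  (v^T *m A *m v) 0 0.

(* The mean and covariance of a law [mu] on R^n are those of the identity,
   seen as a random vector on the probability space (R^n, mu). *)
Definition G2_law (R : realType) (n : nat)
    (mu : probability (n.-tuple R) R) : R :=
  let m := mean_vec mu id in
  let Sigma := cov_mx mu id in
  Num.sqrt
    ((2 * qform (invmx Sigma) m)^-1 *
     fine (\int[mu]_x \int[mu]_y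
             (qform (invmx Sigma) (tvec x - tvec y))%:E)%E).

Definition G2 (R : realType) (n : nat) (d : measure_display)
    (T : measurableType d) (P : probability T R) (X : {RV P >-> n.-tuple R}) :
    R :=
  G2_law (distribution P X).

Definition Gmean (R : realType) (n : nat) (y : 'I_n -> R) : R :=
  Num.sqrt (n%:R / \sum_(i < n) y i ^- 2).

Definition hmean (R : realType) (n : nat) (y : 'I_n -> R) : R :=
  n%:R / \sum_(i < n) (y i)^-1.

(* Main.v *)
(** For uncorrelated entries [Sigma] is diagonal, so the quadratic form of its
    inverse splits as [\sum_i v_i ^+ 2 / s_i], where [s_i] is the variance of
    the [i]-th entry.  The identity [E (c - Z)^2 = (c - E Z)^2 + V Z], applied
    to the inner and then to the outer integral, shows that every coordinate
    contributes [2] to the double integral, which therefore equals [2 n].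
    Finally [m_i ^+ 2 / s_i] is [CV ^- 2] of the [i]-th entry. *)
Require Import Defs.
From mathcomp Require Import all_boot all_order all_algebra.
From mathcomp Require Import all_classical all_reals all_analysis.
From mathcomp Require Import measurable_realfun.

Set Implicit Arguments.
Unset Strict Implicit.
Unset Printing Implicit Defensive.

Import Order.TTheory GRing.Theory Num.Theory.
Import numFieldNormedType.Exports.

Local Open Scope ring_scope.

(** The image-measure formula for nonnegative functions is applied to the positive and negative
    parts of [f] separately. This moves the moments of the law of [X] back to [P]. *)
Lemma expectation_distribution (R : realType) (d d' : measure_display)
    (T : measurableType d) (T' : measurableType d') (P : probability T R)
    (X : {RV P >-> T'}) (f : T' -> R) :
  measurable_fun [set: T'] f ->
  ('E_(distribution P X)[f] = 'E_P[f \o X])%E.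
Proof.
move=> /measurable_EFinP mf.
rewrite unlock [LHS]integralE [RHS]integralE.
rewrite !ge0_integral_distribution//.
- by congr (_ - _)%E; apply: eq_integral => t _; rewrite unlock.
- exact: measurable_funeneg.
- exact: measurable_funepos.
Qed.

Lemma covariance_distribution (R : realType) (d d' : measure_display)
    (T : measurableType d) (T' : measurableType d') (P : probability T R)
    (X : {RV P >-> T'}) (f g : T' -> R) :
  measurable_fun [set: T'] f -> measurable_fun [set: T'] g ->
  covariance (distribution P X) f g = covariance P (f \o X) (g \o X).
Proof.
move=> mf mg; rewrite unlock expectation_distribution//.
  by rewrite !(@expectation_distribution _ _ _ _ _ _ X).
by apply: measurable_funM; apply: measurable_funB.
Qed.

Lemma Lfun2_sqr_lty (R : realType) (d : measure_display)
    (T : measurableType d) (mu : {measure set T -> \bar R}) (f : T -> R) :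
  measurable_fun [set: T] f ->
  (\int[mu]_x (f x ^+ 2)%:E < +oo)%E -> f \in Lfun mu 2%:E.
Proof.
move=> mf f2; rewrite inE; apply/andP; split; rewrite inE//=.
rewrite /finite_norm unlock poweR_lty//.
(* The norm integrates the real power [|f x|] to the 2, which agrees with the ring power
   [f x ^+ 2]. *)
rewrite (eq_integral (fun x => (f x ^+ 2)%:E))// => x _ /=.
by rewrite powR_mulrn// real_normK ?num_real.
Qed.

(** Bias-variance decomposition: [c - Z] has mean [c - E Z] and the same variance as [Z], and its
    second moment is its variance plus the square of its mean. *)
Lemma expectation_sqr_dist (R : realType) (d : measure_display)
    (T : measurableType d) (P : probability T R) (Z : T -> R) (c : R) :
  Z \in Lfun P 2%:E ->
  (\int[P]_t ((c - Z t) ^+ 2)%:E =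
   ((c - fine 'E_P[Z]) ^+ 2 + fine 'V_P[Z])%:E)%E.
Proof.
move=> Z2; have Z1 := Lfun_subset12 (fin_num_measure P _ measurableT) Z2.
have cZ2 : cst c \- Z \in Lfun P 2%:E.
  by rewrite rpredB ?lee1n// => ?; exact: Lfun_cst.
have cZ1 := Lfun_subset12 (fin_num_measure P _ measurableT) cZ2.
have EcZ : ('E_P[cst c \- Z] = (c - fine 'E_P[Z])%:E)%E.
  rewrite expectationB ?Lfun_cst// expectation_cst EFinB fineK//.
  exact: expectation_fin_num.
have := varianceE cZ2.
rewrite varianceB_cst_l// EcZ.
(* The squared mean is added to both sides; being finite, it cancels in the extended reals. *)
move=> /(congr1 (fun x => (x + ((c - fine 'E_P[Z]) ^+ 2)%:E)%E)).
rewrite -EFin_expe subeK// EFinD fineK ?variance_fin_num// addeC => ->.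
by rewrite unlock.
Qed.

(** The diagonal matrix of reciprocals is a right inverse; for square matrices this gives
    invertibility and identifies [invmx]. *)
Lemma qform_inv_diag (F : realType) (n : nat) (s : 'I_n -> F) (v : 'cV[F]_n) :
  (forall i, s i != 0) ->
  qform (invmx (diag_mx (\row_i s i))) v = \sum_i v i 0 ^+ 2 / s i.
Proof.
move=> s0.
have inv : diag_mx (\row_i s i) *m diag_mx (\row_i (s i)^-1) = 1%:M.
  rewrite mulmx_diag -diag_const_mx; congr diag_mx.
  by apply/rowP => i; rewrite !mxE divff.
have [su _] := mulmx1_unit inv.
have -> : invmx (diag_mx (\row_i s i)) = diag_mx (\row_i (s i)^-1).
  by rewrite -[LHS]mulmx1 -inv mulmxA mulVmx// mul1mx.
rewrite /qform mul_mx_diag mxE; apply: eq_bigr => i _.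
by rewrite !mxE mulrAC expr2.
Qed.

Lemma measurable_entry (R : realType) (n : nat) (d : measure_display)
    (T : measurableType d) (X : T -> n.-tuple R) (i : 'I_n) :
  measurable_fun [set: T] X -> measurable_fun [set: T] (entry X i).
Proof. by move=> mX; exact: (measurableT_comp (measurable_tnth i)). Qed.

Lemma finite_second_moment_Lfun2 (R : realType) (n : nat)
    (d : measure_display) (T : measurableType d) (P : probability T R)
    (X : T -> n.-tuple R) (i : 'I_n) :
  measurable_fun [set: T] X -> finite_second_moment P X ->
  entry X i \in Lfun P 2%:E.
Proof.
move=> mX X2; have mXi j := measurable_entry j mX.
apply: Lfun2_sqr_lty => //; apply: le_lt_trans X2.
apply: ge0_le_integral => //.
- by move=> t _; rewrite lee_fin sqr_ge0.
- by apply/measurable_EFinP; exact: measurable_funX.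
- apply/measurable_EFinP; apply: measurable_sum => j.
  exact: measurable_funX.
- move=> t _; rewrite lee_fin (bigD1 i)//= lerDl.
  by apply: sumr_ge0 => j _; exact: sqr_ge0.
Qed.

Lemma finite_second_moment_distribution (R : realType) (n : nat)
    (d : measure_display) (T : measurableType d) (P : probability T R)
    (X : {RV P >-> n.-tuple R}) :
  finite_second_moment P X -> finite_second_moment (distribution P X) id.
Proof.
rewrite /finite_second_moment ge0_integral_distribution//.
- apply/measurable_EFinP; apply: measurable_sum => j.
  by apply: measurable_funX; exact: measurable_entry.
- by move=> x; rewrite lee_fin sumr_ge0// => j _; exact: sqr_ge0.
Qed.

Lemma mean_vec_distribution (R : realType) (n : nat)
    (d : measure_display) (T : measurableType d) (P : probability T R)
    (X : {RV P >-> n.-tuple R}) :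
  mean_vec (distribution P X) id = mean_vec P X.
Proof.
apply/colP => i; rewrite !mxE expectation_distribution//.
exact: measurable_entry.
Qed.

Lemma cov_mx_uncorrelated (R : realType) (n : nat)
    (d : measure_display) (T : measurableType d) (P : probability T R)
    (X : T -> n.-tuple R) :
  uncorrelated_entries P X ->
  cov_mx P X = diag_mx (\row_i fine 'V_P[entry X i]%E).
Proof.
move=> hX; apply/matrixP => i j; rewrite !mxE.
by have [->|ij] := eqVneq i j; rewrite ?mulr1n// mulr0n hX.
Qed.

(** The centre [c] is left free because the formula serves twice: with the coordinates of [x] for
    the inner integral, then with the means for the outer one. *)
Lemma integral_sum_sqr_dist (R : realType) (n : nat)
    (mu : probability (n.-tuple R) R) (s c : 'I_n -> R) :
  finite_second_moment mu id -> (forall i, 0 < s i) ->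
  (\int[mu]_y (\sum_i (c i - tnth y i) ^+ 2 / s i)%:E =
   (\sum_i ((c i - fine 'E_mu[entry id i]) ^+ 2
              + fine 'V_mu[entry id i]) / s i)%:E)%E.
Proof.
move=> mu2 s0; have mi i : measurable_fun setT (fun y : n.-tuple R => tnth y i).
  exact: measurable_tnth.
have msq i : measurable_fun setT
    (fun y : n.-tuple R => (c i - tnth y i) ^+ 2).
  exact/measurable_funX/measurable_funB.
under eq_integral => y _ do rewrite -sumEFin.
rewrite ge0_integral_sum//; first last.
- by move=> i y _; rewrite lee_fin divr_ge0 ?sqr_ge0// ltW.
- by move=> i; apply/measurable_EFinP/measurable_funM.
rewrite -sumEFin; apply: eq_bigr => i _.
under eq_integral => y _ do rewrite EFinM.
rewrite ge0_integralZr//; first last.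
- by rewrite lee_fin invr_ge0 ltW.
- by move=> y _; rewrite lee_fin sqr_ge0.
- exact/measurable_EFinP.
- rewrite EFinM; congr (_ * _)%E.
  by apply: expectation_sqr_dist; exact: finite_second_moment_Lfun2.
Qed.

Lemma double_integral_qform (R : realType) (n : nat)
    (mu : probability (n.-tuple R) R) :
  finite_second_moment mu id -> uncorrelated_entries mu id ->
  (forall i, 0 < fine 'V_mu[entry id i]%E) ->
  (\int[mu]_x \int[mu]_y
     (qform (invmx (cov_mx mu id)) (tvec x - tvec y))%:E = (n%:R *+ 2)%:E)%E.
Proof.
move=> mu2 unc s0.
set m := fun i => fine 'E_mu[entry id i]%E.
set s := fun i => fine 'V_mu[entry id i]%E.
have s_neq0 i : s i != 0 by exact: lt0r_neq0 (s0 i).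
under eq_integral => x _.
  under eq_integral => y _.
    rewrite cov_mx_uncorrelated// qform_inv_diag//.
    under eq_bigr => i _ do rewrite !mxE.
    over.
  rewrite integral_sum_sqr_dist//.
  (* Each variance term divided by [s i] gives 1, hence [n] in total. The square is flipped to
     [(m i - x_i) ^+ 2] so that it has the shape of the same formula centred at [m]. *)
  under eq_bigr => i _ do rewrite mulrDl (divff (s_neq0 i)) -sqrrN opprB.
  rewrite big_split/= sumr_const card_ord EFinD.
  over.
rewrite ge0_integralD//.
- rewrite integral_cst//= probability_setT mule1.
  rewrite (integral_sum_sqr_dist m mu2 s0).
  (* Centred at the means, the bias vanishes and only the variance terms remain: a second [n]. *)
  under eq_bigr => i _ do rewrite subrr expr0n add0r (divff (s_neq0 i)).
  by rewrite sumr_const card_ord -EFinD mulr2n.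
- move=> x _; rewrite lee_fin sumr_ge0// => i _.
  by rewrite divr_ge0 ?sqr_ge0// ltW.
- apply/measurable_EFinP; apply: measurable_sum => i.
  apply: measurable_funM => //; apply: measurable_funX.
  apply: measurable_funB => //; exact: measurable_tnth.
Qed.

Lemma G2_law_uncorrelated (R : realType) (n : nat)
    (mu : probability (n.-tuple R) R) :
  finite_second_moment mu id -> uncorrelated_entries mu id ->
  (forall i, 0 < fine 'V_mu[entry id i]%E) ->
  G2_law mu = Num.sqrt (n%:R / \sum_i mean_vec mu id i 0 ^+ 2
                                      / fine 'V_mu[entry id i]%E).
Proof.
move=> mu2 unc s0.
rewrite /G2_law double_integral_qform// cov_mx_uncorrelated//.
rewrite qform_inv_diag => [|i]; last exact: lt0r_neq0.
(* The factor 2 of the double integral cancels the one in the normalisation of [G2_law]. *)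
by rewrite /= -[n%:R *+ 2]mulr_natl invfM mulrACA mulVf ?pnatr_eq0// mul1r mulrC.
Qed.

(** The determinant of the diagonal covariance matrix is the product of the variances; if it is
    nonzero, so is each of these nonnegative factors. *)
Lemma variance_gt0_unitmx (R : realType) (n : nat)
    (d : measure_display) (T : measurableType d) (P : probability T R)
    (X : T -> n.-tuple R) (i : 'I_n) :
  uncorrelated_entries P X -> cov_mx P X \in unitmx ->
  0 < fine 'V_P[entry X i]%E.
Proof.
move=> unc; rewrite cov_mx_uncorrelated// unitmxE det_diag unitfE.
move=> /prodf_neq0/(_ i isT); rewrite mxE => s0.
by rewrite lt_def s0 fine_ge0// variance_ge0.
Qed.

Theorem theorem2 (R : realType) (n : nat) (hn : (0 < n)%N)
    (d : measure_display) (T : measurableType d) (P : probability T R)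
    (X : {RV P >-> n.-tuple R})
    (hX2 : finite_second_moment P X)
    (huncorr : uncorrelated_entries P X)
    (hSigma : cov_mx P X \in unitmx)
    (hmean0 : forall i : 'I_n, ('E_P[entry X i])%E <> 0%E) :
  G2 X = Gmean (fun i : 'I_n => CV P (entry X i)) /\
  G2 X ^+ 2 = hmean (fun i : 'I_n => CV P (entry X i) ^+ 2).
Proof.
(* [G2] only sees the law of [X]; this identity carries covariances, and with [i = j] variances,
   over to the entries of [X]. *)
have covE i j : covariance (distribution P X) (entry id i) (entry id j) =
                covariance P (entry X i) (entry X j).
  by rewrite covariance_distribution//; exact: measurable_entry.
have s0 i : 0 < fine 'V_P[entry X i]%E by exact: variance_gt0_unitmx.
have G2E : G2 X = Gmean (fun i => CV P (entry X i)).
  rewrite /G2 G2_law_uncorrelated.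
  - congr (Num.sqrt (_ / _)); apply: eq_bigr => i _.
    (* It remains to see that [CV ^- 2] is the squared mean over the variance; the root squares back
       because the variance is nonnegative. *)
    rewrite mean_vec_distribution mxE /CV /variance covE expr_div_n.
    rewrite sqr_sqrtr; last exact: ltW (s0 i).
    by rewrite invf_div real_normK ?num_real.
  - exact: finite_second_moment_distribution.
  - by move=> i j ij; rewrite covE huncorr.
  - by move=> i; rewrite /variance covE; exact: s0.
(* The radicand is nonnegative, so squaring removes the root; as [y ^- 2] is the inverse of
   [y ^+ 2], what is left is the harmonic mean of the squares. *)
split=> //; rewrite G2E /Gmean sqr_sqrtr// divr_ge0// sumr_ge0// => i _.
by rewrite invr_ge0 sqr_ge0.
Qed.
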